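(* Let $\alpha\in(0,1/2)$. For every integer $0<\ell<\infty$ there is $r_0>0$ such that $\mathrm{det}_{\ell'}^{f_\alpha}(x,r)=1$ for every $0<r<r_0$, every integer $0<\ell'\le\ell$ and every $x\in[0,1]$.
   Context: For $\alpha\in(0,1/2)$ the continuous map $f_\alpha:[0,1]\to[0,1]$ is defined by: $f_\alpha(x)=x-1+2\alpha^{j-1}-\alpha^j$ for $x\in[1-\alpha^{j-1},1-\alpha^{j-1}+\alpha^j]$, $j\ge1$; $f_\alpha(x)=\frac{1-\alpha+\alpha^2}{2\alpha-1}(x-1)+\alpha^{j+1}\frac{2-\alpha}{2\alpha-1}$ for $x\in(1-\alpha^{j-1}+\alpha^j,1-\alpha^j)$, $j\ge1$; and $f_\alpha(1)=0$. For $1\le\ell\le\infty$ put $\varrho_\ell(x,y)=\sup\{|f_\alpha^i(x)-f_\alpha^i(y)| : 0\le i<\ell\}$. For $x\in[0,1]$, $n\ge1$, $r>0$, the $\ell$-recurrence rate $\mathrm{RR}_\ell^{f_\alpha}(x,n,r)$ is $\frac1{n^2}$ times the number of pairs $(i,j)$ with $0\le i,j<n$ for which there is $0\le k\le\min\{i,j,\ell-1\}$ with $\varrho_\ell(f_\alpha^{i-k}(x),f_\alpha^{j-k}(x))\le r$. The $\ell$-determinism is $\mathrm{DET}_\ell^{f_\alpha}(x,n,r)=\mathrm{RR}_\ell^{f_\alpha}(x,n,r)/\mathrm{RR}_1^{f_\alpha}(x,n,r)$, and $\mathrm{det}_\ell^{f_\alpha}(x,r)=\lim_{n\to\infty}\mathrm{DET}_\ell^{f_\alpha}(x,n,r)$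 (this limit exists for all $x\in[0,1]$, $1\le \ell\le\infty$ and $r\in(0,1]$). *)

(* Defs.v *)
From HB Require Import structures.
From mathcomp Require Import all_boot all_order all_algebra.
From mathcomp Require Import all_classical all_reals all_analysis.
From mathcomp Require Import ring lra.

Set Implicit Arguments.
Unset Strict Implicit.
Unset Printing Implicit Defensive.

Import Order.TTheory GRing.Theory Num.Theory.
Import numFieldNormedType.Exports.

Local Open Scope classical_set_scope.
Local Open Scope ring_scope.

Section RecurrenceDeterminism.
Context {R : realType}.
Implicit Types (f : R -> R) (x y r : R) (l n : nat).

(** The orders [l] are finite and meant to be positive. *)
Definition bowen_dist f l x y : R :=
  sup [set `|iter i f x - iter i f y| | i in [set i | (i < l)%N]].

(** The proportion of pairs (i, j) in [0, n)^2 for which some k with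
    0 <= k <= min(i, j, l - 1) satisfies
    bowen_dist f l (f^(i-k) x) (f^(j-k) x) <= r. *)
Definition recurrence_rate f l x n r : R :=
  #|[pred p : 'I_n * 'I_n |
      [exists k : 'I_(minn (minn p.1 p.2) l.-1).+1,
        bowen_dist f l (iter (p.1 - k) f x) (iter (p.2 - k) f x) <= r]]|%:R
  / n%:R ^+ 2.

Definition determinism f l x n r : R :=
  recurrence_rate f l x n r / recurrence_rate f 1 x n r.

(** [limn] is total: a statement about [asymptotic_det] should come with the
    convergence of the sequence. *)
Definition asymptotic_det f l x r : R :=
  limn (fun n => determinism f l x n r).

End RecurrenceDeterminism.

Section SolenoidalMap.
Context {R : realType}.
Implicit Types (a x y : R).

Definition falpha_graph a x y : Prop :=
  [\/ exists2 j : nat, (1 <= j)%N &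
        1 - a ^+ j.-1 <= x <= 1 - a ^+ j.-1 + a ^+ j /\
        y = x - 1 + 2 * a ^+ j.-1 - a ^+ j,
      exists2 j : nat, (1 <= j)%N &
        1 - a ^+ j.-1 + a ^+ j < x < 1 - a ^+ j /\
        y = (1 - a + a ^+ 2) / (2 * a - 1) * (x - 1)
            + a ^+ j.+1 * ((2 - a) / (2 * a - 1))
    | x = 1 /\ y = 0].

(** The map on [0, 1] with graph [falpha_graph a], extended by 0 to the reals;
    that the graph is functional on [0, 1] when 0 < a < 1/2 is shown by
    [falpha_graph_uniq] and [falphaP]. *)
Definition falpha a x : R := xget 0 [set y | falpha_graph a x y].

Lemma falpha_ex a x : 0 < a < 1 / 2 -> 0 <= x <= 1 ->
  exists y, falpha_graph a x y.
Proof.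
move=> /andP[a0 a12] /andP[x0 x1].
have a_lt1 : a < 1 by lra.
have [->|xn1] := eqVneq x 1; first by exists 0; apply: Or33.
have {}x1 : 0 < 1 - x by rewrite subr_gt0 lt_neqAle xn1.
have exj : exists j, a ^+ j < 1 - x.
  have /cvgrPdist_lt/(_ _ x1) : (fun n => a ^+ n) @ \oo --> (0 : R).
    by apply: cvg_expr; rewrite gtr0_norm.
  case=> N _ /(_ N (leqnn N)); rewrite /= sub0r normrN gtr0_norm ?exprn_gt0 //.
  by exists N.
case: (ex_minnP exj) => -[|j] jx jmin; first by rewrite expr0 in jx; lra.
have ajx : 1 - a ^+ j <= x.
  by have := jmin j; rewrite ltnn; case: ltP => [_ /(_ isT)//|]; lra.
have [xj|xj] := leP x (1 - a ^+ j + a ^+ j.+1).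
  by eexists; apply: Or31; exists j.+1 => //; split; [rewrite /= ajx xj|].
by eexists; apply: Or32; exists j.+1 => //; split; [rewrite /= xj /=; lra|].
Qed.

Lemma falpha_graph_uniq a x y z : 0 < a < 1 / 2 ->
  falpha_graph a x y -> falpha_graph a x z -> y = z.
Proof.
move=> /andP[a0 a12].
have aS j : 0 < a ^+ j.+1 /\ 2 * a ^+ j.+1 < a ^+ j.
  have aj0 : 0 < a ^+ j by rewrite exprn_gt0.
  by rewrite exprS mulr_gt0//; split => //; nra.
have decomp t : falpha_graph a x t -> (x = 1 /\ t = 0) \/
    exists j, 1 - a ^+ j <= x < 1 - a ^+ j.+1 /\
      t = if x <= 1 - a ^+ j + a ^+ j.+1 then x - 1 + 2 * a ^+ j - a ^+ j.+1
          else (1 - a + a ^+ 2) / (2 * a - 1) * (x - 1)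
            + a ^+ j.+2 * ((2 - a) / (2 * a - 1)).
  case=> [[[//|j] _ /= [/andP[jx xj] ->]]|[[//|j] _ /= [/andP[jx xj] ->]]|].
  - right; exists j; rewrite jx xj; split => //=.
    by have [] := aS j; lra.
  - right; exists j; rewrite xj (leNgt x) jx; split => //=; rewrite andbT.
    by have [] := aS j; lra.
  - by left.
have below1 j : x < 1 - a ^+ j.+1 -> x <> 1 by have [] := aS j; lra.
have aux m n : x < 1 - a ^+ m.+1 -> 1 - a ^+ n <= x -> (n <= m)%N.
  move=> xm nx; rewrite leqNgt; apply/negP => mn.
  have : a ^+ n <= a ^+ m.+1 by apply: ler_wiXn2l => //; lra.
  by lra.
move=> /decomp[[x1 ->]|[i [/andP[ix xi] ->]]]
  /decomp[[x1' ->]|[j [/andP[jx xj] ->]]] //.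
- by case: (below1 _ xj).
- by case: (below1 _ xi).
- by have -> : i = j by apply/eqP; rewrite eqn_leq !aux.
Qed.

Lemma falphaP a x y : 0 < a < 1 / 2 -> 0 <= x <= 1 ->
  falpha_graph a x y <-> falpha a x = y.
Proof.
move=> ha hx; have g : falpha_graph a x (falpha a x).
  have [t gt] := falpha_ex ha hx.
  by rewrite /falpha; case: xgetP => [y' _ //|/(_ t)].
by split=> [|<-//]; apply: falpha_graph_uniq.
Qed.

Lemma falpha_itv a x : 0 < a < 1 / 2 -> 0 <= x <= 1 -> 0 <= falpha a x <= 1.
Proof.
move=> ha hx; have /falphaP := erefl (falpha a x); move=> /(_ ha hx).
case/andP: ha => a0 a12.
have aj j : 0 < a ^+ j <= 1.
  by rewrite exprn_gt0// exprn_ile1// ?ltW//; lra.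
move: (falpha a x) => y; case=> [[[//|j] _ /=]|[[//|j] _ /=]|[_ ->]];
  last by rewrite lexx ler01.
- move=> [/andP[jx xj] ->]; have /andP[aj0 aj1] := aj j.
  have ? : a ^+ j.+1 <= a ^+ j by rewrite exprS; nra.
  by apply/andP; split; lra.
- move=> [/andP[jx xj] ->]; have /andP[aj0 aj1] := aj j.
  have d0 : 0 < 1 - 2 * a by lra.
  rewrite !exprS in jx xj *; move: (a ^+ j) aj0 aj1 jx xj => b b0 b1 jx xj.
  have dn0 : 2 * a - 1 != 0 by lra.
  set y' := (X in 0 <= X <= 1).
  have yE : (1 - 2 * a) * y' = (1 - a + a ^+ 2) * (1 - x) - a * (a * b) * (2 - a).
    by rewrite /y' expr0; field.
  have aa : 0 < 1 - a + a ^+ 2 by nra.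
  apply/andP; split.
    rewrite -(pmulr_rge0 _ d0) yE.
    have : 0 <= (1 - a + a ^+ 2) * (1 - x - a * b) by apply: mulr_ge0; lra.
    have : 0 <= a * b * (1 - 2 * a) * (1 - a).
      by rewrite !mulr_ge0//; lra.
    by lra.
  rewrite -(ler_pM2l d0) yE mulr1.
  have : 0 <= (1 - a + a ^+ 2) * (b - a * b - (1 - x)) by apply: mulr_ge0; lra.
  have : 0 <= (1 - b) * (1 - 2 * a) by rewrite mulr_ge0//; lra.
  by lra.
Qed.

End SolenoidalMap.

(* Main.v *)
(** The relation f(1 - a + a z) = a f(z) makes f^2 on [0, a] a copy of f scaled
    by a; iterating, f^(2^m) on [0, a^m] is a copy of f scaled by a^m, and the
    iterates f^i with i < 2^m are translations of [0, a^m] onto intervals which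
    are a^m (1 - 2 a) apart.  Since f is affine and expanding on the gap
    (a, 1 - a), every orbit either enters [0, a^l] or lands on a^m y with m <= l
    and f y = y.  So for r < a^l (1 - 2 a), two late points of an orbit that are
    r-close are at the same phase modulo 2^m: in the periodic case they are
    equal, and otherwise, as l <= 2^l, the two orbits can be traced back to a
    common time from which they move by the same translations for l' <= l steps.
    Thus the pairs counted by RR_1 and not by RR_l' have a bounded coordinate:
    there are O(n) of them, while by the pigeonhole principle RR_1 counts at
    least a fixed proportion of the n^2 pairs. *)

Require Import Defs.
From HB Require Import structures.
From mathcomp Require Import all_boot all_order all_algebra.
From mathcomp Require Import all_classical all_reals all_analysis.
From mathcomp Require Import zify ring lra.

Import Order.TTheory GRing.Theory Num.Theory.
Import numFieldNormedType.Exports.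

Local Open Scope classical_set_scope.
Local Open Scope ring_scope.

(** * Counting pairs of indices *)

(** If [c] is the most frequent value of [b], its fibre has at least [n / M] elements, and all pairs
    from that fibre are counted. *)
Lemma pigeonhole_pairs (M n : nat) (b : 'I_n -> 'I_M) :
  (n ^ 2 <= M ^ 2 * #|[pred p : 'I_n * 'I_n | b p.1 == b p.2]|)%N.
Proof.
case: n b => [|n] b; first by [].
pose N c := #|[pred i | b i == c]|.
have [c _ Nmax] : {c | xpredT c & forall c', (N c' <= N c)%N}.
  case: (arg_maxnP N (i0 := b ord0) (P := xpredT)) => // c _ h.
  by exists c => // c'; apply: h.
have le_n : (n.+1 <= M * N c)%N.
  rewrite -{1}(card_ord n.+1) -sum1_card (partition_big b xpredT) //=.
  rewrite -[M in (M * _)%N]card_ord -sum_nat_const.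
  by apply: leq_sum => c' _; rewrite sum1_card; apply: Nmax.
apply: (@leq_trans ((M * N c) ^ 2)%N); first by rewrite leq_exp2r.
rewrite expnMn leq_mul2l; apply/orP; right.
rewrite -mulnn -cardX; apply: subset_leq_card; apply/fintype.subsetP => -[i j].
by rewrite !inE /= => /andP[/eqP -> /eqP ->].
Qed.

Lemma card_ord_pairs_lt (T n : nat) :
  (#|[pred p : 'I_n * 'I_n | (p.1 < T) || (p.2 < T)]| <= 2 * T.+1 * n)%N.
Proof.
have small : (#|[pred i : 'I_n | (i < T)%N]| <= T.+1)%N.
  rewrite -[leqRHS]card_ord.
  (* The bound uses [T.+1] rather than [T] because [inord] needs a nonempty codomain, also when
     [T = 0]. *)
  apply: (@leq_card_in _ _ (fun i : 'I_n => inord i : 'I_T.+1)).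
  move=> i j; rewrite !inE => iT jT /(congr1 val) /=.
  by rewrite !inordK ?ltnS ?(ltnW iT) ?(ltnW jT) //; apply: val_inj.
pose A := [predX [pred i : 'I_n | (i < T)%N] & predT : pred 'I_n].
pose B := [predX (predT : pred 'I_n) & [pred i : 'I_n | (i < T)%N]].
apply: (@leq_trans (#|A| + #|B|)%N).
  rewrite -cardUI; apply: leq_trans (leq_addr _ _).
  apply: subset_leq_card; apply/fintype.subsetP => -[i j].
  by rewrite !inE /= andbT.
rewrite !cardX !card_ord [leqRHS]mulnC (mulnC #|_| n) -mulnDr leq_mul2l.
by rewrite mul2n -addnn leq_add ?orbT.
Qed.

(** * Recurrent pairs of a general map, and a criterion for determinism to tend to 1 *)

Section Determinism.
Context {R : realType}.
Implicit Types (f : R -> R) (x y r : R).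

Lemma bowen_dist_le f (l : nat) x y r : (0 < l)%N ->
  bowen_dist f l x y <= r <->
  forall s, (s < l)%N -> `|iter s f x - iter s f y| <= r.
Proof.
move=> l0; split=> [le_r s sl|le_r].
  apply: le_trans le_r; apply: ub_le_sup; last by exists s.
  exists (\sum_(i < l) `|iter i f x - iter i f y|) => _ [i il <-].
  by rewrite (bigD1 (Ordinal il)) //= lerDl sumr_ge0.
apply: ge_sup; first by eexists; exists 0.
by move=> _ [i il <-]; apply: le_r.
Qed.

Definition recurrent_pairs f (l : nat) x (n : nat) r : pred ('I_n * 'I_n) :=
  [pred p : 'I_n * 'I_n |
    [exists k : 'I_(minn (minn p.1 p.2) l.-1).+1,
      bowen_dist f l (iter (p.1 - k) f x) (iter (p.2 - k) f x) <= r]].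

Lemma recurrent_pairsP f (l : nat) x (n : nat) r (i j : 'I_n) : (0 < l)%N ->
  reflect (exists k : nat, [/\ (k <= i)%N, (k <= j)%N, (k < l)%N &
      forall s, (s < l)%N ->
        `|iter (s + (i - k)) f x - iter (s + (j - k)) f x| <= r])
    ((i, j) \in recurrent_pairs f l x n r).
Proof.
move=> l0; apply: (iffP existsP) => /=; last first.
  case=> k [ki kj kl h].
  have kP : (k < (minn (minn i j) l.-1).+1)%N.
    by rewrite ltnS !leq_min ki kj /= -ltnS prednK.
  exists (Ordinal kP); apply/bowen_dist_le => //= s sl.
  by rewrite -!iterD; apply: h.
case=> -[k kP] /= /bowen_dist_le h; move: kP.
rewrite ltnS !leq_min -andbA => /and3P[ki kj kl].
exists k; split=> //; first by rewrite -(prednK l0) ltnS.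
by move=> s sl; rewrite !iterD; apply: h.
Qed.

Arguments recurrent_pairsP {f l x n r i j}.

Lemma recurrent_pairs1 f x (n : nat) r (i j : 'I_n) :
  ((i, j) \in recurrent_pairs f 1 x n r) = (`|iter i f x - iter j f x| <= r).
Proof.
apply/idP/idP => [/(recurrent_pairsP (l := 1) isT)[k [_ _]]|h].
  by rewrite ltnS leqn0 => /eqP -> /(_ 0%N isT); rewrite !add0n !subn0.
apply/recurrent_pairsP => //; exists 0%N; split=> // -[|//] _.
by rewrite !add0n !subn0.
Qed.

(** At time [s = k] the condition on the iterates compares the points of indices [i] and [j]
    themselves. *)
Lemma sub_recurrent_pairs1 f (l : nat) x (n : nat) r : (0 < l)%N ->
  {subset recurrent_pairs f l x n r <= recurrent_pairs f 1 x n r}.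
Proof.
move=> l0 [i j] /(recurrent_pairsP l0)[k [ki kj kl /(_ k kl)]].
by rewrite recurrent_pairs1 !subnKC.
Qed.

(** Boxes of length [r], at most [M] in number, cover [0, 1]; indices whose points share a box are
    [r]-close, so the pigeonhole count applies. *)
Lemma card_recurrent_pairs1 f x (n : nat) r : 0 < r ->
  (forall i, 0 <= iter i f x <= 1) ->
  (n ^ 2 <= (Num.truncn r^-1).+1 ^ 2 * #|recurrent_pairs f 1 x n r|)%N.
Proof.
move=> r0 x01; set M := (Num.truncn r^-1).+1.
have box_lt i : (Num.truncn (iter i f x / r) < M)%N.
  have /andP[i0 i1] := x01 i.
  by rewrite ltnS; apply: le_truncn; rewrite ler_piMl // invr_ge0 ltW.
pose box (i : 'I_n) : 'I_M := Ordinal (box_lt i).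
apply: leq_trans (pigeonhole_pairs _ _ box) _.
rewrite leq_mul2l; apply/orP; right.
apply: subset_leq_card; apply/fintype.subsetP => -[i j].
rewrite inE /= recurrent_pairs1 => /eqP/(congr1 val) /= eq_box.
have itv k : (Num.truncn (iter k f x / r))%:R <= iter k f x / r
    < (Num.truncn (iter k f x / r)).+1%:R.
  rewrite truncnS_gt andbT truncn_le divr_ge0 ?(ltW r0) //.
  by have /andP[] := x01 k.
have /andP[i1 i2] := itv i; have /andP[j1 j2] := itv j.
rewrite -eq_box -natr1 in j1 j2; rewrite -natr1 in i2.
rewrite -[leRHS]mul1r -ler_pdivrMr // -{1}(gtr0_norm r0) -normf_div mulrBl.
by rewrite ler_norml; lra.
Qed.

(** The numerator misses at most [2 * T.+1 * n] pairs of the denominator, those with an index below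
    [T], while the denominator has at least [n ^ 2 / M ^ 2] pairs. Hence for positive [n] the
    quotient lies between [1 - C / n] and 1. *)
Lemma determinism_cvg1 f (l : nat) x r (T : nat) : (0 < l)%N -> 0 < r ->
  (forall i, 0 <= iter i f x <= 1) ->
  (forall i j, (T <= i)%N -> (T <= j)%N -> `|iter i f x - iter j f x| <= r ->
    exists k : nat, [/\ (k <= i)%N, (k <= j)%N, (k < l)%N &
      forall s, (s < l)%N ->
        `|iter (s + (i - k)) f x - iter (s + (j - k)) f x| <= r]) ->
  (fun n => determinism f l x n r) @ \oo --> (1 : R).
Proof.
move=> l0 r0 x01 lifts.
set M := (Num.truncn r^-1).+1.
pose C : R := (2 * T.+1 * M ^ 2)%N%:R.
(* The shift excludes [n = 0], and [harmonic n] is then exactly the inverse of the orbit length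
   [n.+1]. *)
rewrite -cvg_shiftS.
apply: (@squeeze_cvgr _ _ _ _ (fun n => 1 - C * harmonic n) (fun=> 1));
  last exact: cvg_cst.
- near=> n; rewrite /determinism /recurrence_rate /=.
  rewrite -/(recurrent_pairs f l x n.+1 r) -/(recurrent_pairs f 1 x n.+1 r).
  set A := #|recurrent_pairs f 1 x n.+1 r|.
  set B := #|recurrent_pairs f l x n.+1 r|.
  have nA : (n.+1 ^ 2 <= M ^ 2 * A)%N by apply: card_recurrent_pairs1.
  have BA : (B <= A)%N.
    by apply: subset_leq_card; apply/fintype.subsetP/sub_recurrent_pairs1.
  have AB : (A <= B + 2 * T.+1 * n.+1)%N.
    apply: leq_trans (leq_add (leqnn B) (card_ord_pairs_lt T n.+1)).
    rewrite -cardUI; apply: leq_trans (leq_addr _ _).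
    apply: subset_leq_card; apply/fintype.subsetP => -[i j].
    rewrite recurrent_pairs1 !inE /= => ij.
    have [|Ti] /= := ltnP i T; first by rewrite orbT.
    have [|Tj] /= := ltnP j T; first by rewrite orbT.
    by rewrite orbF; apply/recurrent_pairsP => //; apply: lifts.
  have A0 : (0 < A)%N.
    by move: nA; case: (A) => //; rewrite muln0 leqn0.
  (* The common normalisation cancels, leaving [B / A]. *)
  rewrite -mulf_div divff ?mulr1; last first.
    by rewrite invr_eq0 expf_neq0 // pnatr_eq0.
  have A0' : 0 < A%:R :> R by rewrite ltr0n.
  rewrite ler_pdivlMr // ler_pdivrMr // mul1r ler_nat BA andbT.
  move: nA AB; rewrite -!(ler_nat R) natrD /C -!mulnn !natrM /harmonic /=.
  have : 0 < n.+1%:R :> R by rewrite ltr0n.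
  set N := n.+1%:R => N0 nA AB.
  have key : 2 * T.+1%:R * N <= 2 * T.+1%:R * (M%:R * M%:R) / N * A%:R.
    rewrite [leRHS]mulrAC ler_pdivlMr // -!mulrA ler_pM2l ?ltr0n //.
    by rewrite ler_pM2l ?ltr0n // mulrA.
  by rewrite mulrBl mul1r lerBlDr (le_trans AB) ?lerD2l.
- have : (fun n => 1 - C * harmonic n) @ \oo --> (1 - C * 0 : R).
    apply: cvgB; first exact: cvg_cst.
    by apply: cvgM; [exact: cvg_cst|exact: cvg_harmonic].
  by rewrite mulr0 subr0.
Unshelve. all: by end_near.
Qed.

End Determinism.

(** * Renormalization of the map *)

Section Renormalization.
Context {R : realType}.
Variable a : R.
Hypothesis ha : 0 < a < 1 / 2.
Let f := falpha a.
Implicit Types (x y z w : R) (i j m n : nat).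

Let a_gt0 : 0 < a. Proof. by case/andP: ha. Qed.
Let a_lt1 : a < 1. Proof. by case/andP: ha; lra. Qed.

Lemma scale_itv m z : 0 <= z <= 1 -> 0 <= a ^+ m * z <= 1.
Proof.
case/andP=> z0 z1; have am0 : 0 <= a ^+ m by rewrite exprn_ge0 // ltW.
by rewrite mulr_ge0 //= mulr_ile1 // exprn_ile1 // ltW.
Qed.

Lemma iter_falpha_itv i x : 0 <= x <= 1 -> 0 <= iter i f x <= 1.
Proof. by move=> x01; elim: i => //= i; apply: falpha_itv. Qed.

Lemma falpha_left x : 0 <= x <= a -> f x = x + 1 - a.
Proof.
move: a_lt1 => a1 /andP[x0 xa]; apply/falphaP => //.
  by apply/andP; split; lra.
apply: Or31; exists 1%N => //=; rewrite expr0 expr1; split; last by ring.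
by apply/andP; split; lra.
Qed.

Lemma falpha_gap x : a < x < 1 - a ->
  f x = (1 - a + a ^+ 2) / (2 * a - 1) * (x - 1)
        + a ^+ 2 * ((2 - a) / (2 * a - 1)).
Proof.
move: a_gt0 => a0 /andP[ax xa]; apply/falphaP => //.
  by apply/andP; split; lra.
apply: Or32; exists 1%N => //=; rewrite expr0 expr1; split=> //.
by apply/andP; split; lra.
Qed.

(** Replacing z by 1 - a + a z carries the j-th piece of the graph to the piece of index j + 1 and
    multiplies its values by a. *)
Lemma falpha_right z : 0 <= z <= 1 -> f (1 - a + a * z) = a * f z.
Proof.
move: a_gt0 a_lt1 => a0 a1 hz; have /andP[z0 z1] := hz.
have az : 0 <= 1 - a + a * z <= 1 by apply/andP; split; nra.
have /falphaP := erefl (f z); move=> /(_ ha hz) fz.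
apply/falphaP => //; case: fz => [[[//|j] _ /=]|[[//|j] _ /=]|[-> ->]].
- move=> [/andP[jz zj] ->]; apply: Or31; exists j.+2 => //=.
  rewrite !exprS in jz zj *; split; last by ring.
  by apply/andP; split; nra.
- move=> [/andP[jz zj] ->]; apply: Or32; exists j.+2 => //=.
  rewrite !exprS in jz zj *; split; last by ring.
  by apply/andP; split; nra.
- by apply: Or33; split; ring.
Qed.

(** The first step translates [0, a] by 1 - a, which puts the point in the range of
    [falpha_right]. *)
Lemma iter2_falpha z : 0 <= z <= 1 -> f (f (a * z)) = a * f z.
Proof.
move: a_gt0 a_lt1 => a0 a1 hz; have /andP[z0 z1] := hz.
rewrite (@falpha_left (a * z)); last by apply/andP; split; nra.
by rewrite -falpha_right //; congr f; ring.
Qed.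

Lemma iter_double_falpha i z : 0 <= z <= 1 ->
  iter i.*2 f (a * z) = a * iter i f z.
Proof.
move=> hz; elim: i => //= i ->.
by rewrite iter2_falpha // iter_falpha_itv.
Qed.

Lemma iter_double_falphaS i z : 0 <= z <= 1 ->
  iter i.*2.+1 f (a * z) = a * iter i f z + 1 - a.
Proof.
move=> hz; rewrite iterS iter_double_falpha // falpha_left //.
move: a_gt0 => a0; have /andP[? ?] := iter_falpha_itv i _ hz.
by apply/andP; split; nra.
Qed.

Lemma iter_pow2_falpha m i z : 0 <= z <= 1 ->
  iter (i * 2 ^ m) f (a ^+ m * z) = a ^+ m * iter i f z.
Proof.
elim: m => [|m IH] hz; first by rewrite muln1 expr0 !mul1r.
by rewrite expnS mulnCA mul2n exprS -!mulrA iter_double_falpha ?scale_itv // IH.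
Qed.

(** Induction on [m] removes the last binary digit of [i]: halving the time extracts one factor [a],
    and at odd times the extra translation by 1 - a is common to both points and cancels. *)
Lemma iter_falpha_isometry m i z w : (i < 2 ^ m)%N ->
  0 <= z <= 1 -> 0 <= w <= 1 ->
  `|iter i f (a ^+ m * z) - iter i f (a ^+ m * w)| = a ^+ m * `|z - w|.
Proof.
elim: m i z w => [|m IH] i z w im hz hw.
  by case: i im => // _; rewrite expr0 !mul1r.
have ih : (i./2 < 2 ^ m)%N by rewrite ltn_half_double -mul2n -expnS.
have aM y y' : a * `|y - y'| = `|a * y - a * y'|.
  by rewrite -mulrBr normrM (gtr0_norm a_gt0).
rewrite [in RHS]exprS -[RHS]mulrA -(IH _ _ _ ih hz hw) aM.
rewrite -[in LHS](odd_double_half i) [a ^+ m.+1]exprS -!mulrA; case: (odd i).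
  by rewrite add1n !iter_double_falphaS ?scale_itv //; congr `|_|; ring.
by rewrite add0n !iter_double_falpha ?scale_itv.
Qed.

(** For times of different parity one point lies in [0, a] and the other in [1 - a, 1], at distance
    at least 1 - 2a. For equal parity, halve both times and rescale by [a]. *)
Lemma iter_falpha_separated m i j z w : (i < 2 ^ m)%N -> (j < 2 ^ m)%N ->
  i != j -> 0 <= z <= 1 -> 0 <= w <= 1 ->
  a ^+ m * (1 - 2 * a) <= `|iter i f (a ^+ m * z) - iter j f (a ^+ m * w)|.
Proof.
have a0 := a_gt0; have a2 : 0 < 1 - 2 * a by case/andP: ha; lra.
elim: m i j z w => [|m IH] i j z w im jm ij hz hw.
  by case: i j im jm ij => [|i] // [].
have half_lt k : (k < 2 ^ m.+1)%N -> (k./2 < 2 ^ m)%N.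
  by rewrite ltn_half_double -mul2n -expnS.
have far y y' : 0 <= y <= 1 -> 0 <= y' <= 1 ->
    a ^+ m.+1 * (1 - 2 * a) <= `|a * y + 1 - a - a * y'|.
  move=> /andP[y0 y1] /andP[y'0 y'1]; apply: (@le_trans _ _ (1 - 2 * a)).
    by rewrite ler_piMl ?exprn_ile1 ?ltW.
  by rewrite ler_normr; apply/orP; left; nra.
have itv k y : 0 <= y <= 1 -> 0 <= iter k f (a ^+ m * y) <= 1.
  by move=> hy; apply/iter_falpha_itv/scale_itv.
have := IH _ _ z w (half_lt _ im) (half_lt _ jm).
move: ij; rewrite -{1 4}(odd_double_half i) -{1 4}(odd_double_half j).
rewrite [a ^+ m.+1]exprS -!mulrA.
have aM y y' : a * `|y - y'| = `|a * y - a * y'|.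
  by rewrite -mulrBr normrM (gtr0_norm a_gt0).
case: (odd i); case: (odd j); rewrite ?add1n ?add0n => ij sep.
- have {}ij : i./2 != j./2 by apply: contraNneq ij => ->.
  rewrite !iter_double_falphaS ?scale_itv //.
  have -> u v : a * u + 1 - a - (a * v + 1 - a) = a * u - a * v by ring.
  by rewrite -aM ler_pM2l // sep.
- rewrite iter_double_falphaS ?iter_double_falpha ?scale_itv //.
  by rewrite mulrA -exprS far ?itv.
- rewrite iter_double_falphaS ?iter_double_falpha ?scale_itv // distrC.
  by rewrite mulrA -exprS far ?itv.
- have {}ij : i./2 != j./2 by apply: contraNneq ij => ->.
  by rewrite !iter_double_falpha ?scale_itv // -aM ler_pM2l // sep.
Qed.

(** * Entrance of orbits into small intervals *)

(** Otherwise the orbit stays forever in the gap (a, 1 - a), where the distance to the fixed point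
    of the affine branch grows geometrically; this is impossible in [0, 1]. *)
Lemma falpha_fixed_or_left x : 0 <= x <= 1 ->
  (exists t, f (iter t f x) = iter t f x) \/ (exists t, 0 <= iter t f x <= a).
Proof.
move=> hx; have [|no_fix] := pselect (exists t, f (iter t f x) = iter t f x).
  by left.
have [|no_left] := pselect (exists t, 0 <= iter t f x <= a); first by right.
exfalso.
have itv t := iter_falpha_itv t _ hx.
have gap t : a < iter t f x < 1 - a.
  have /andP[t0 t1] := itv t; apply/andP; split; rewrite ltNge; apply/negP => ht.
    by apply: no_left; exists t; rewrite t0.
  apply: no_left; exists t.+1; rewrite iterS.
  (* A point of [1 - a, 1] has the form 1 - a + a z, so its image [a * f z] lies in [0, a]. *)
  pose z := (iter t f x - (1 - a)) / a.
  have z01 : 0 <= z <= 1.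
    by rewrite divr_ge0 ?subr_ge0 ?(ltW a_gt0) //= ler_pdivrMr // mul1r; lra.
  have -> : iter t f x = 1 - a + a * z by rewrite /z; field; rewrite gt_eqF.
  rewrite falpha_right //; have /andP[fz0 fz1] := falpha_itv ha z01.
  by rewrite mulr_ge0 ?(ltW a_gt0) //= ler_piMr // ltW.
have d0 : 0 < 1 - 2 * a by case/andP: ha; lra.
(* [p] is the fixed point of the affine branch on the gap, [- lam] its slope. *)
pose p := (1 - a ^+ 2) / (2 - a).
pose lam := (1 - a + a ^+ 2) / (1 - 2 * a).
have lam1 : 1 < lam.
  by move: a_gt0 => a0; rewrite /lam ltr_pdivlMr // mul1r expr2; nra.
have affine t : f (iter t f x) - p = - lam * (iter t f x - p).
  have n1 : 1 - 2 * a != 0 by rewrite gt_eqF.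
  have n2 : 2 * a - 1 != 0 by rewrite -opprB oppr_eq0.
  have n3 : 2 - a != 0 by rewrite gt_eqF // subr_gt0 (lt_trans a_lt1) // ltr1n.
  by rewrite falpha_gap // /lam /p; field; rewrite n1 n2 n3.
have expand t : `|iter t f x - p| = lam ^+ t * `|x - p|.
  elim: t => [|t IH]; first by rewrite expr0 mul1r.
  rewrite iterS affine normrM normrN IH exprS mulrA gtr0_norm //.
  exact: lt_trans lam1.
have xp : 0 < `|x - p|.
  rewrite normr_gt0 subr_eq0; apply/eqP => xp; apply: no_fix; exists 0%N.
  have := affine 0%N; rewrite /= xp subrr mulr0 => /eqP.
  by rewrite subr_eq0 => /eqP.
have lam0 : 0 < lam by apply: lt_trans lam1.
(* At this [t] the orbit is at distance more than 1 from [p], although both lie in [0, 1]. *)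
have [t small] : exists t, lam^-1 ^+ t < `|x - p|.
  have /cvgrPdist_lt/(_ _ xp) : (fun n => lam^-1 ^+ n) @ \oo --> (0 : R).
    by apply: cvg_expr; rewrite gtr0_norm ?invr_gt0 // invf_lt1.
  case=> N _ /(_ N (leqnn N)); rewrite /= sub0r normrN gtr0_norm.
    by exists N.
  by rewrite exprn_gt0 // invr_gt0.
have : 1 < `|iter t f x - p|.
  by rewrite expand -ltr_pdivrMl ?exprn_gt0 // mulr1 -exprVn.
have p01 : 0 <= p <= 1.
  move: a_gt0 a_lt1 => a0 a1; rewrite /p ler_pdivlMr ?ler_pdivrMr; try by lra.
  by rewrite mul0r mul1r expr2; apply/andP; split; nra.
have /andP[? ?] := itv t; case/andP: p01 => ? ?.
by rewrite ltNge ler_norml => /negP; apply; apply/andP; split; lra.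
Qed.

(** Induction on [N]: apply the dichotomy to the rescaled point [y], whose orbit is followed by
    every [2 ^ N]-th iterate. Reaching [0, a] releases one more factor [a]; a fixed point ends the
    descent at the current level. *)
Lemma falpha_entrance N x : 0 <= x <= 1 ->
  exists t m y, [/\ (m <= N)%N, 0 <= y <= 1, iter t f x = a ^+ m * y &
    m = N \/ f y = y].
Proof.
move=> hx; elim: N => [|N [t [m [y [mN hy ty]]]]].
  by exists 0%N, 0%N, x; split=> //; [rewrite expr0 mul1r|left].
case=> [mE|fy]; last by exists t, m, y; split=> //; [exact: leqW|right].
rewrite {}mE {m mN} in ty *.
have scaled s : iter (s * 2 ^ N + t) f x = a ^+ N * iter s f y.
  by rewrite iterD ty iter_pow2_falpha.
have [[s fs]|[s /andP[s0 sa]]] := falpha_fixed_or_left _ hy.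
  exists (s * 2 ^ N + t)%N, N, (iter s f y).
  by split=> //; [rewrite iter_falpha_itv|right].
exists (s * 2 ^ N + t)%N, N.+1, (iter s f y / a); split=> //; last by left.
  by rewrite divr_ge0 ?(ltW a_gt0) //= ler_pdivrMr // mul1r.
by rewrite scaled exprSr -mulrA; congr (_ * _); field; rewrite gt_eqF.
Qed.

End Renormalization.

(** * Close returns of the solenoidal map *)

Theorem theorem30 (R : realType) (a : R) (ha : 0 < a < 1 / 2) (l : nat)
    (hl : (0 < l)%N) :
  exists r0 : R, 0 < r0 /\
    forall r : R, 0 < r < r0 ->
    forall l' : nat, (0 < l' <= l)%N ->
    forall x : R, 0 <= x <= 1 ->
      cvgn (fun n : nat => determinism (falpha a) l' x n r) /\
      asymptotic_det (falpha a) l' x r = 1.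
Proof.
have /andP[a0 a12] := ha; have a2 : 0 < 1 - 2 * a by lra.
(* The separation at level [l] is the smallest among the levels [m <= l], so one bound serves every
   [x], whatever level its orbit stops at. *)
exists (a ^+ l * (1 - 2 * a)); split; first by rewrite mulr_gt0 ?exprn_gt0.
move=> r /andP[r_gt0 r_lt] l' /andP[l'0 l'l] x hx.
suff det1 : (fun n => determinism (falpha a) l' x n r) @ \oo --> (1 : R).
  by split; [exact: cvgP det1|exact: cvg_lim det1].
have [t [m [y [ml hy xt mfix]]]] := falpha_entrance a ha l x hx.
have phase u q : iter (u + q * 2 ^ m + t) (falpha a) x =
    iter u (falpha a) (a ^+ m * iter q (falpha a) y).
  by rewrite -addnA !iterD xt iter_pow2_falpha.
(* Here [s] is the phase in a cycle of length [2 ^ m] and [q] the number of cycles completed since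
   time [t]. *)
have decomp i : (t <= i)%N ->
    exists s q, (s < 2 ^ m)%N /\ i = (s + q * 2 ^ m + t)%N.
  move=> ti; exists ((i - t) %% 2 ^ m)%N, ((i - t) %/ 2 ^ m)%N.
  by rewrite ltn_mod expn_gt0 addnC (addnC (_ %% _)%N) -divn_eq subnKC.
have yitv q : 0 <= iter q (falpha a) y <= 1 by apply: iter_falpha_itv.
apply: (determinism_cvg1 _ _ _ _ t) => //; last move=> i j.
  by move=> i; apply: iter_falpha_itv.
move=> /decomp[s [q [sm ->]]] /decomp[s' [q' [s'm ->]]] near.
have ss' : s = s'.
  apply/eqP; apply: contraT => ss'; move: near; rewrite !phase leNgt => /negP[].
  apply: lt_le_trans (iter_falpha_separated a ha m s s' _ _ sm s'm ss' _ _) => //.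
  apply: (lt_le_trans r_lt); rewrite ler_pM2r //.
  by apply: ler_wiXn2l => //; [exact: ltW|lra].
subst s'.
case: mfix => [mE|fy].
  (* Going back this many steps stays within the current cycle. The window of [l'] times either ends
     at phase [s] or starts at phase 0, where [l' <= l < 2 ^ l] keeps it inside the cycle. *)
  exists (minn s l'.-1); split; try by lia.
  move=> u ul.
  have shift q0 : (u + (s + q0 * 2 ^ m + t - minn s l'.-1))%N
      = (u + (s - minn s l'.-1) + q0 * 2 ^ m + t)%N by lia.
  have um : (u + (s - minn s l'.-1) < 2 ^ m)%N.
    by have := ltn_expl m (isT : 1 < 2)%N; lia.
  by move: near; rewrite !shift !phase !iter_falpha_isometry.
have yfix q0 : iter q0 (falpha a) y = y by elim: q0 => //= q0 ->.
(* In the periodic case points at the same phase coincide, so no step back is needed. *)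
exists 0%N; split=> // u _.
rewrite !subn0 !iterD xt !iter_pow2_falpha // !yfix.
by rewrite subrr normr0 ltW.
Qed.
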